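(* Let $m\geq 2$ be an integer, let $\kappa\geq 0$ be a real number and let $D>0$. Let $\bar{\mu}_1(m,\kappa,D)$ be the first nonzero Neumann eigenvalue of the one-dimensional eigenvalue problem $$\varphi''-\left(4(m-1)T_{\kappa}+3T_{4\kappa}\right)\varphi'=-\lambda\varphi$$ on $[-D/2,D/2]$. Then $$\bar{\mu}_1(m,\kappa,D)\geq \sup_{s\in(0,1)}\left(4s(1-s)\frac{\pi^2}{D^2}+4s(m+2)\kappa\right).$$
   Context: For $\kappa\geq0$: $T_\kappa(t)=\sqrt{\kappa}\tan(\sqrt{\kappa}\,t)$ if $\kappa>0$, and $T_0(t)=0$. The Neumann condition is $\varphi'(-D/2)=\varphi'(D/2)=0$. The number $D$ is such that the coefficient $4(m-1)T_{\kappa}+3T_{4\kappa}$ is finite on $[-D/2,D/2]$, so that the eigenvalue problem makes sense. *)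

(* Defs.v *)
From Stdlib Require Import Reals.
From Coquelicot Require Import Coquelicot.
Open Scope R_scope.

Definition T (kappa t : R) : R :=
  if Rlt_dec 0 kappa then sqrt kappa * tan (sqrt kappa * t) else 0.

(* [tan] is a total function, so [T kappa] has no pole: finiteness at [t]
   has to be stated separately, as the nonvanishing of the denominator. *)
Definition T_finite (kappa t : R) : Prop :=
  0 < kappa -> cos (sqrt kappa * t) <> 0.

Definition drift (m : nat) (kappa t : R) : R :=
  4 * (INR m - 1) * T kappa t + 3 * T (4 * kappa) t.

(* A pole of [T kappa] is a zero of [T (4 * kappa)], and [T kappa] is finite at
   every pole of [T (4 * kappa)]: for [m >= 2] the [drift] is finite
   exactly where both of its terms are. *)
Definition drift_finite (kappa t : R) : Prop :=
  T_finite kappa t /\ T_finite (4 * kappa) t.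

Definition itv (D t : R) : Prop := - (D / 2) <= t <= D / 2.

(* [D_in f df K t] says that [df t] is the derivative of [f] at [t] within [K],
   hence a one-sided derivative at the two endpoints; the values of [phi]
   outside the interval are irrelevant. The equation makes [phi''] continuous
   on the interval, so these solutions are the C^2 ones. *)
Definition neumann_eigenfunction (m : nat) (kappa D lambda : R)
    (phi : R -> R) : Prop :=
  (exists t, itv D t /\ phi t <> 0) /\
  exists phi' phi'' : R -> R,
    (forall t, itv D t ->
       D_in phi phi' (itv D) t /\
       D_in phi' phi'' (itv D) t /\
       phi'' t - drift m kappa t * phi' t = - lambda * phi t) /\
    phi' (- (D / 2)) = 0 /\ phi' (D / 2) = 0.

Definition neumann_eigenvalue (m : nat) (kappa D lambda : R) : Prop :=
  exists phi : R -> R, neumann_eigenfunction m kappa D lambda phi.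

Definition first_nonzero_neumann_eigenvalue (m : nat) (kappa D mu : R) : Prop :=
  neumann_eigenvalue m kappa D mu /\ mu <> 0 /\
  forall lambda : R,
    neumann_eigenvalue m kappa D lambda -> lambda <> 0 -> mu <= lambda.

(* Main.v *)
Require Import Defs.
From Stdlib Require Import Reals Lra.
From Coquelicot Require Import Coquelicot.
Open Scope R_scope.

(** Let [w = phi'], let [a] be the drift and [p = 1 / (1 - s)].  Differentiating
    the equation gives [w'' = a w' + (a' - lambda) w] with [w = 0] at both
    endpoints.  Testing this against [|w|^(p-2) w], the drift terms combine into
    a total derivative and there remains
      [lambda * int |w|^p = 4 s (1-s) * int (|w|^(p/2))'^2 + s * int a' |w|^p].
    Since [a' >= 4 (m+2) kappa], which follows from [T' = kappa + T^2], and since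
    a function that vanishes at the endpoints of an interval of length [D] has
    Dirichlet energy at least [PI^2/D^2] times its squared norm, this is the
    claimed bound.

    The proof below is the pointwise (Picone) form of that computation, which
    needs neither integrals nor the zeros of [w].  For [0 < theta < PI/D] put
    [h t = 4 s (1-s) theta tan (theta t)], smooth on the closed interval, and
      [G = |w|^(p-2) w w' + (h - (1-s) a) |w|^p].
    Wherever [w <> 0], completing a square gives
      [G' >= |w|^p (s a' + 4 s (1-s) theta^2 - lambda)]
    ([picone_square]).  If [lambda < 4 s (1-s) theta^2 + s inf a'], then [G' > 0]
    where [w <> 0], while [G = 0] where [w = 0], in particular at the endpoints.
    So neither the maximum nor the minimum of [G] can be at a point with
    [w <> 0], hence [G = 0] everywhere, which forces [w = 0]
    ([derivative_vanishes]).  Then [lambda * phi = 0] and [lambda = 0].  So a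
    nonzero eigenvalue is at least [4 s (1-s) theta^2 + s inf a'] for every
    [theta < PI/D], and [theta] can be taken arbitrarily close to [PI/D]. *)

(** * The powers [|x|^p] and [|x|^p / x] *)

(** [Rpower 0 p] is not [0], so the value at [0] is set apart. *)
Definition abs_power (p x : R) : R :=
  if Req_EM_T x 0 then 0 else Rpower (Rabs x) p.

(** This is [|x|^(p-2) x]; at [0] its value is [0], because [abs_power p 0] is. *)
Definition signed_power (p x : R) : R := abs_power p x / x.

Lemma abs_power_0 p : abs_power p 0 = 0.
Proof. unfold abs_power; destruct (Req_EM_T 0 0); [reflexivity | lra]. Qed.

Lemma signed_power_0 p : signed_power p 0 = 0.
Proof. unfold signed_power; rewrite abs_power_0; unfold Rdiv; ring. Qed.

Lemma abs_power_pos p x : x <> 0 -> 0 < abs_power p x.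
Proof.
  intros hx; unfold abs_power; destruct (Req_EM_T x 0); [easy |].
  apply exp_pos.
Qed.

Lemma abs_power_signed_power p x : abs_power p x = x * signed_power p x.
Proof.
  unfold signed_power; destruct (Req_EM_T x 0) as [-> | hx].
  - rewrite abs_power_0; ring.
  - field; exact hx.
Qed.

Lemma is_derive_abs_power p x :
  x <> 0 -> is_derive (abs_power p) x (p * signed_power p x).
Proof.
  intros hx.
  apply (is_derive_ext_loc (fun y => exp (p * ln (Rabs y)))).
  - assert (h : 0 < Rabs x) by (apply Rabs_pos_lt; exact hx).
    exists (mkposreal _ h); intros y hy.
    unfold abs_power; destruct (Req_EM_T y 0) as [-> | _]; [| reflexivity].
    unfold ball in hy; simpl in hy; unfold AbsRing_ball, abs, minus, plus, opp in hy;
      simpl in hy.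
    rewrite Rplus_0_l, Rabs_Ropp in hy; lra.
  - unfold signed_power, abs_power, Rpower.
    destruct (Req_EM_T x 0) as [| _]; [easy |].
    auto_derive.
    + split; [exact hx |]. split; [apply Rabs_pos_lt; exact hx | exact I].
    + destruct (Rdichotomy x 0 hx) as [h | h].
      * rewrite (sign_eq_m1 x h), (Rabs_left x h); field; lra.
      * rewrite (sign_eq_1 x h), (Rabs_right x ltac:(lra)); field; lra.
Qed.

Lemma is_derive_signed_power p x :
  x <> 0 -> is_derive (signed_power p) x ((p - 1) * (abs_power p x / x ^ 2)).
Proof.
  intros hx.
  evar_last.
  - apply (is_derive_div (abs_power p) (fun y => y)).
    + apply is_derive_abs_power; exact hx.
    + apply @is_derive_id.
    + exact hx.
  - unfold signed_power, one; simpl; field; exact hx.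
Qed.

(** Away from [0] this is differentiability; at [0] it is where [1 < p] enters,
    through [|signed_power p x| = |x|^(p-1)]. *)
Lemma continuous_signed_power p x : 1 < p -> continuous (signed_power p) x.
Proof.
  intros hp; destruct (Req_EM_T x 0) as [-> | hx].
  - apply continuity_pt_filterlim; intros eps heps.
    exists (Rpower eps (/ (p - 1))); split; [apply exp_pos |].
    intros y [_ hy]; simpl in *; unfold Rdist in *.
    rewrite signed_power_0, Rminus_0_r; rewrite Rminus_0_r in hy.
    destruct (Req_EM_T y 0) as [-> | hy0].
    { rewrite signed_power_0, Rabs_R0; exact heps. }
    assert (h : 0 < Rabs y) by (apply Rabs_pos_lt; exact hy0).
    assert (e : Rabs (signed_power p y) = Rpower (Rabs y) (p - 1)).
    { unfold signed_power, abs_power; destruct (Req_EM_T y 0); [easy |].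
      unfold Rdiv; rewrite Rabs_mult, Rabs_inv.
      unfold Rminus; rewrite Rpower_plus, Rpower_Ropp, Rpower_1 by exact h.
      rewrite (Rabs_right (Rpower _ _)); [reflexivity |].
      left; apply exp_pos. }
    rewrite e.
    replace eps with (Rpower (Rpower eps (/ (p - 1))) (p - 1)).
    + apply Rlt_Rpower_l; lra.
    + rewrite Rpower_mult, Rinv_l, Rpower_1; lra.
  - apply @ex_derive_continuous; eexists; apply is_derive_signed_power; exact hx.
Qed.

Lemma continuous_abs_power p x : 1 < p -> continuous (abs_power p) x.
Proof.
  intros hp.
  apply (continuous_ext (fun y : R => y * signed_power p y)).
  - intros y; symmetry; apply abs_power_signed_power.
  - apply @continuous_mult; [apply continuous_id |].
    apply continuous_signed_power; exact hp.
Qed.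

(** * Functions on a closed interval *)

(** Precomposing with the retraction of the line onto the interval turns
    one-sided continuity at the endpoints into continuity. *)
Definition clamp (D t : R) : R := Rmax (- (D / 2)) (Rmin t (D / 2)).

Lemma clamp_itv D t : 0 < D -> itv D (clamp D t).
Proof.
  intros hD; unfold clamp, itv, Rmax, Rmin.
  destruct (Rle_dec t (D / 2)); destruct (Rle_dec _ _); lra.
Qed.

Lemma clamp_id D t : itv D t -> clamp D t = t.
Proof.
  unfold clamp, itv, Rmax, Rmin; intros ht.
  destruct (Rle_dec t (D / 2)); destruct (Rle_dec _ _); lra.
Qed.

Lemma clamp_lipschitz D x y : 0 < D -> Rabs (clamp D x - clamp D y) <= Rabs (x - y).
Proof.
  intros hD; unfold clamp, Rmax, Rmin.
  destruct (Rle_dec x (D / 2)); destruct (Rle_dec y (D / 2));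
    repeat destruct (Rle_dec _ _); unfold Rabs; repeat destruct (Rcase_abs _); lra.
Qed.

Lemma continuous_clamp D t : 0 < D -> continuous (clamp D) t.
Proof.
  intros hD; apply continuity_pt_filterlim; intros eps heps.
  exists eps; split; [exact heps |].
  intros y [_ hy]; simpl in *; unfold Rdist in *.
  eapply Rle_lt_trans; [apply clamp_lipschitz; exact hD | exact hy].
Qed.

Lemma continuous_D_in_clamp D f df t :
  0 < D -> (forall x, itv D x -> D_in f df (itv D) x) ->
  continuous (fun x => f (clamp D x)) t.
Proof.
  intros hD hf; apply continuity_pt_filterlim; intros eps heps.
  destruct (cont_deriv _ _ _ _ (hf _ (clamp_itv D t hD)) eps heps)
    as [delta [hdelta hlim]].
  exists delta; split; [exact hdelta |].
  intros y [_ hy]; simpl in *; unfold Rdist in *.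
  destruct (Req_EM_T (clamp D t) (clamp D y)) as [e | hne].
  { rewrite e, Rminus_diag, Rabs_R0; exact heps. }
  apply hlim; split; [split; [apply clamp_itv; exact hD | exact hne] |].
  eapply Rle_lt_trans; [apply clamp_lipschitz; exact hD | exact hy].
Qed.

Lemma is_derive_D_in D f df t :
  - (D / 2) < t < D / 2 -> D_in f df (itv D) t -> is_derive f t (df t).
Proof.
  intros ht hf; apply is_derive_Reals; intros eps heps.
  destruct (hf eps heps) as [delta [hdelta hlim]].
  assert (hm : 0 < Rmin delta (Rmin (t - - (D / 2)) (D / 2 - t))).
  { repeat apply Rmin_pos; lra. }
  exists (mkposreal _ hm); intros x hx hxm; simpl in *; unfold Rdist in *.
  assert (b1 := Rmin_l delta (Rmin (t - - (D / 2)) (D / 2 - t))).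
  assert (b2 := Rmin_r delta (Rmin (t - - (D / 2)) (D / 2 - t))).
  assert (b3 := Rmin_l (t - - (D / 2)) (D / 2 - t)).
  assert (b4 := Rmin_r (t - - (D / 2)) (D / 2 - t)).
  assert (b5 := Rle_abs x). assert (b6 := Rle_abs (- x)). rewrite Rabs_Ropp in b6.
  specialize (hlim (t + x)).
  replace (t + x - t) with x in hlim by ring.
  apply hlim; split; [| lra].
  unfold D_x, itv; lra.
Qed.

Lemma D_in_zero D f df t :
  0 < D -> itv D t -> (forall x, itv D x -> f x = 0) ->
  D_in f df (itv D) t -> df t = 0.
Proof.
  intros hD ht hf hd.
  destruct (Req_EM_T (df t) 0) as [h | h]; [exact h | exfalso].
  destruct (hd _ (Rabs_pos_lt _ h)) as [delta [hdelta hlim]].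
  assert (hx : exists x, itv D x /\ t <> x /\ Rabs (x - t) < delta).
  { assert (b1 := Rmin_l delta D). assert (b2 := Rmin_r delta D).
    assert (b3 : 0 < Rmin delta D) by (apply Rmin_pos; lra).
    unfold itv in *.
    (* There is room for a step of length [D/2] from [t] towards the midpoint. *)
    destruct (Rle_dec t 0).
    - exists (t + Rmin delta D / 2); repeat split; try lra.
      apply Rabs_def1; lra.
    - exists (t - Rmin delta D / 2); repeat split; try lra.
      apply Rabs_def1; lra. }
  destruct hx as [x [hx [hne hdist]]].
  specialize (hlim x); simpl in hlim; unfold Rdist in hlim.
  rewrite (hf x hx), (hf t ht) in hlim.
  replace ((0 - 0) / (x - t) - df t) with (- df t) in hlim by (field; lra).
  rewrite Rabs_Ropp in hlim.
  apply (Rlt_irrefl (Rabs (df t))), hlim; split; [| exact hdist].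
  split; assumption.
Qed.

(** An extremum of [G] at a point with [w <> 0] would be interior and critical.
    So both extreme values of [G] are attained where [w = 0] and are [0]; then
    [G] is constant and every point is an extremum. *)
Lemma zero_of_pos_derivative D (G w : R -> R) :
  0 < D ->
  (forall t, continuous (fun x => G (clamp D x)) t) ->
  (forall t, w t = 0 -> G t = 0) ->
  w (- (D / 2)) = 0 -> w (D / 2) = 0 ->
  (forall t, - (D / 2) < t < D / 2 -> w t <> 0 ->
     exists d, is_derive G t d /\ 0 < d) ->
  forall t, itv D t -> w t = 0.
Proof.
  intros hD hcont hz hl hr hpos.
  assert (hc : forall c, - (D / 2) <= c <= D / 2 ->
             continuity_pt (fun x => G (clamp D x)) c).
  { intros c _; apply continuity_pt_filterlim, hcont. }
  assert (hle : - (D / 2) <= D / 2) by lra.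
  assert (hext : forall t, itv D t ->
            (forall x, itv D x -> G x <= G t) \/ (forall x, itv D x -> G t <= G x) ->
            w t = 0).
  { intros t [h1 h2] hmm.
    destruct (Req_EM_T (w t) 0) as [h | h]; [exact h | exfalso].
    assert (h1' : - (D / 2) < t) by (destruct h1; [assumption | subst; easy]).
    assert (h2' : t < D / 2) by (destruct h2; [assumption | subst; easy]).
    destruct (hpos t (conj h1' h2') h) as [d [hd hd0]].
    assert (hd' := proj1 (is_derive_Reals _ _ _) hd).
    assert (e : d = 0).
    { destruct hmm as [hm | hm].
      - apply (deriv_maximum G _ _ t (exist _ d hd') h1' h2').
        intros x h3 h4; apply hm; unfold itv; lra.
      - apply (deriv_minimum G _ _ t (exist _ d hd') h1' h2').
        intros x h3 h4; apply hm; unfold itv; lra. }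
    lra. }
  destruct (continuity_ab_maj _ _ _ hle hc) as [M [hM hMi]].
  destruct (continuity_ab_min _ _ _ hle hc) as [N [hN hNi]].
  assert (hM' : forall x, itv D x -> G x <= G M).
  { intros x hx; specialize (hM x hx); rewrite !clamp_id in hM; assumption. }
  assert (hN' : forall x, itv D x -> G N <= G x).
  { intros x hx; specialize (hN x hx); rewrite !clamp_id in hN; assumption. }
  assert (eM := hz M (hext M hMi (or_introl hM'))).
  assert (eN := hz N (hext N hNi (or_intror hN'))).
  intros t ht; apply hext; [exact ht | left].
  intros x hx; generalize (hM' x hx) (hN' t ht); lra.
Qed.

(** * The Picone argument for a general drift *)

(** Here [p = 1/(1-s)], [r = w'/w], [tau = tan (theta t)] and
    [h = 4 s (1-s) theta tau], so the right side is [(p-1) r^2 + p h r + h'].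
    It exceeds the left side by [p / (4 s) * (2 s r + h)^2], since [h] solves
    [h' - h^2 / (4 s (1-s)) = 4 s (1-s) theta^2]. *)
Lemma picone_square s theta tau r :
  0 < s < 1 ->
  4 * s * (1 - s) * theta ^ 2 <=
  (/ (1 - s) - 1) * r ^ 2
  + / (1 - s) * (4 * s * (1 - s) * theta * tau) * r
  + 4 * s * (1 - s) * theta ^ 2 * (1 + tau ^ 2).
Proof.
  intros hs.
  assert (0 <= s / (1 - s) * (r + 2 * (1 - s) * theta * tau) ^ 2).
  { apply Rmult_le_pos; [| apply pow2_ge_0].
    apply Rlt_le, Rdiv_lt_0_compat; lra. }
  replace (_ + _ + _)
    with (s / (1 - s) * (r + 2 * (1 - s) * theta * tau) ^ 2
          + 4 * s * (1 - s) * theta ^ 2) by (field; lra).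
  lra.
Qed.

Lemma is_derive_tan_scaled theta t :
  cos (theta * t) <> 0 ->
  is_derive (fun x => tan (theta * x)) t (theta * (1 + tan (theta * t) ^ 2)).
Proof.
  intros hc; evar_last.
  - apply (is_derive_comp tan (fun x => theta * x)).
    + apply is_derive_tan; exact hc.
    + auto_derive; [exact I | reflexivity].
  - unfold scal; simpl; unfold mult; simpl; ring.
Qed.

Lemma cos_scaled_pos D theta t :
  0 < theta -> theta * D < PI -> itv D t -> 0 < cos (theta * t).
Proof. intros h1 h2 [h3 h4]; apply cos_gt_0; nra. Qed.

(** The equation turns [w'] into [a w - lambda phi], so the function [G] of the
    Picone argument becomes
    [(s a + h) |w|^p - lambda phi |w|^(p-2) w], which is continuous up to the
    endpoints because [phi] and [phi'] are. *)
Lemma derivative_vanishes D lambda s theta K (a da phi phi' phi'' : R -> R) :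
  0 < D -> 0 < s < 1 -> 0 < theta -> theta * D < PI ->
  (forall t, itv D t -> is_derive a t (da t) /\ K <= da t) ->
  (forall t, itv D t -> D_in phi phi' (itv D) t /\ D_in phi' phi'' (itv D) t /\
     phi'' t - a t * phi' t = - lambda * phi t) ->
  phi' (- (D / 2)) = 0 -> phi' (D / 2) = 0 ->
  lambda < 4 * s * (1 - s) * theta ^ 2 + s * K ->
  forall t, itv D t -> phi' t = 0.
Proof.
  intros hD hs htheta hthetaD ha hphi hl hr hlt.
  set (p := / (1 - s)).
  assert (hp : 1 < p) by (unfold p; rewrite <- Rinv_1; apply Rinv_lt_contravar; lra).
  set (h := fun t => 4 * s * (1 - s) * theta * tan (theta * t)).
  set (G := fun t => (s * a t + h t) * abs_power p (phi' t)
                     - lambda * phi t * signed_power p (phi' t)).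
  assert (hh : forall t, itv D t -> is_derive h t
            (4 * s * (1 - s) * theta ^ 2 * (1 + tan (theta * t) ^ 2))).
  { intros t ht; unfold h; evar_last.
    - apply @is_derive_scal, is_derive_tan_scaled.
      apply Rgt_not_eq, (cos_scaled_pos D); assumption.
    - unfold scal; simpl; unfold mult; simpl; ring. }
  apply (zero_of_pos_derivative D G phi' hD).
  - intros t; unfold G.
    assert (hca : continuous (fun x => a (clamp D x)) t).
    { apply (continuous_comp (clamp D) a); [apply continuous_clamp; exact hD |].
      apply @ex_derive_continuous; eexists; apply ha, clamp_itv; exact hD. }
    assert (hch : continuous (fun x => h (clamp D x)) t).
    { apply (continuous_comp (clamp D) h); [apply continuous_clamp; exact hD |].
      apply @ex_derive_continuous; eexists; apply hh, clamp_itv; exact hD. }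
    assert (hcp : continuous (fun x => phi (clamp D x)) t).
    { apply (continuous_D_in_clamp D phi phi' t hD); apply hphi. }
    assert (hcw : continuous (fun x => phi' (clamp D x)) t).
    { apply (continuous_D_in_clamp D phi' phi'' t hD); apply hphi. }
    apply @continuous_minus; apply @continuous_mult.
    + apply @continuous_plus; [| exact hch].
      apply @continuous_mult; [apply continuous_const | exact hca].
    + apply (continuous_comp (fun x => phi' (clamp D x)) (abs_power p)); [exact hcw |].
      apply continuous_abs_power; exact hp.
    + apply @continuous_mult; [apply continuous_const | exact hcp].
    + apply (continuous_comp (fun x => phi' (clamp D x)) (signed_power p)); [exact hcw |].
      apply continuous_signed_power; exact hp.
  - intros t h0; unfold G; rewrite h0, abs_power_0, signed_power_0; ring.
  - exact hl.
  - exact hr.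
  - intros t hti hw.
    assert (ht : itv D t) by (unfold itv; lra).
    destruct (ha t ht) as [hda hK].
    destruct (hphi t ht) as [h1 [h2 he]].
    apply (is_derive_D_in D) in h1; [| exact hti].
    apply (is_derive_D_in D) in h2; [| exact hti].
    set (Q := abs_power p (phi' t)).
    set (r := phi'' t / phi' t).
    set (tau := tan (theta * t)).
    exists (Q * ((p - 1) * r ^ 2 + p * (4 * s * (1 - s) * theta * tau) * r
                 + 4 * s * (1 - s) * theta ^ 2 * (1 + tau ^ 2)
                 + s * da t - lambda)).
    split.
    + evar_last.
      * unfold G.
        apply @is_derive_minus.
        -- apply (is_derive_mult (fun x => s * a x + h x) (fun x => abs_power p (phi' x))).
           ++ apply @is_derive_plus; [apply @is_derive_scal; exact hda | apply hh; exact ht].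
           ++ apply (is_derive_comp (abs_power p) phi');
                [apply is_derive_abs_power; exact hw | exact h2].
           ++ apply Rmult_comm.
        -- apply (is_derive_mult (fun x => lambda * phi x)
                                 (fun x => signed_power p (phi' x))).
           ++ apply @is_derive_scal; exact h1.
           ++ apply (is_derive_comp (signed_power p) phi');
                [apply is_derive_signed_power; exact hw | exact h2].
           ++ apply Rmult_comm.
      * unfold minus, plus, opp, scal; simpl; unfold mult; simpl.
        unfold signed_power; fold Q; fold tau; unfold h; fold tau; unfold r.
        replace (lambda * phi t) with (a t * phi' t - phi'' t) by lra.
        unfold p; field; lra.
    + apply Rmult_lt_0_compat; [apply abs_power_pos; exact hw |].
      assert (hsq := picone_square s theta tau r hs); fold p in hsq.
      assert (s * K <= s * da t) by (apply Rmult_le_compat_l; lra).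
      lra.
Qed.

(** * The tangent drift *)

Lemma is_derive_T kappa t :
  0 <= kappa -> T_finite kappa t -> is_derive (T kappa) t (kappa + T kappa t ^ 2).
Proof.
  intros hk hf; unfold T, T_finite in *; destruct (Rlt_dec 0 kappa) as [h | h].
  - evar_last.
    + apply @is_derive_scal, is_derive_tan_scaled, hf, h.
    + unfold scal; simpl; unfold mult; simpl.
      assert (e := sqrt_sqrt kappa hk); set (q := sqrt kappa) in *.
      rewrite <- e; ring.
  - evar_last; [apply @is_derive_const |].
    unfold zero; simpl; replace kappa with 0 by lra; ring.
Qed.

(** [4 (m+2) kappa = 4 (m-1) kappa + 3 * 4 kappa] collects the constant terms of
    the Riccati equations for [T kappa] and [T (4 kappa)]. *)
Lemma is_derive_drift m kappa t :
  (1 <= m)%nat -> 0 <= kappa -> drift_finite kappa t ->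
  exists d, is_derive (drift m kappa) t d /\ 4 * (INR m + 2) * kappa <= d.
Proof.
  intros hm hk [h1 h4].
  exists (4 * (INR m - 1) * (kappa + T kappa t ^ 2)
          + 3 * (4 * kappa + T (4 * kappa) t ^ 2)); split.
  - unfold drift; apply @is_derive_plus; apply @is_derive_scal; apply is_derive_T;
      try assumption; lra.
  - apply le_INR in hm; simpl in hm.
    assert (0 <= (INR m - 1) * T kappa t ^ 2).
    { apply Rmult_le_pos; [lra | apply pow2_ge_0]. }
    generalize (pow2_ge_0 (T (4 * kappa) t)); lra.
Qed.

Lemma exists_square_between c E x :
  0 < c -> 0 < x -> E < c * x ^ 2 ->
  exists theta, 0 < theta < x /\ E < c * theta ^ 2.
Proof.
  intros hc hx hE.
  set (y := (Rmax 0 (E / c) + x ^ 2) / 2).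
  assert (hx2 : 0 < x ^ 2) by (apply pow_lt; exact hx).
  assert (hEc : E / c < x ^ 2).
  { apply (Rmult_lt_reg_l c); [exact hc |].
    replace (c * (E / c)) with E by (field; lra); exact hE. }
  assert (hM : Rmax 0 (E / c) < x ^ 2) by (apply Rmax_lub_lt; assumption).
  assert (b1 := Rmax_l 0 (E / c)). assert (b2 := Rmax_r 0 (E / c)).
  exists (sqrt y); repeat split.
  - apply sqrt_lt_R0; unfold y; lra.
  - rewrite <- (sqrt_pow2 x) by lra; apply sqrt_lt_1; unfold y; lra.
  - rewrite pow2_sqrt by (unfold y; lra).
    replace E with (c * (E / c)) by (field; lra).
    apply Rmult_lt_compat_l; unfold y; lra.
Qed.

Lemma nonzero_eigenvalue_lower_bound m kappa D lambda s :
  (1 <= m)%nat -> 0 <= kappa -> 0 < D ->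
  (forall t, itv D t -> drift_finite kappa t) ->
  neumann_eigenvalue m kappa D lambda -> lambda <> 0 -> 0 < s < 1 ->
  4 * s * (1 - s) * (PI ^ 2 / D ^ 2) + 4 * s * (INR m + 2) * kappa <= lambda.
Proof.
  intros hm hk hD hfin [phi [[t0 [ht0 hphi0]] [phi' [phi'' [hphi [hl hr]]]]]] hne hs.
  apply Rnot_lt_le; intros hlt.
  set (K := 4 * (INR m + 2) * kappa).
  destruct (exists_square_between (4 * s * (1 - s)) (lambda - s * K) (PI / D))
    as [theta [[hth0 hth1] hth2]].
  - nra.
  - apply Rdiv_lt_0_compat; [apply PI_RGT_0 | exact hD].
  - replace ((PI / D) ^ 2) with (PI ^ 2 / D ^ 2) by (field; lra).
    unfold K; lra.
  - assert (hthD : theta * D < PI).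
    { replace PI with (PI / D * D) by (field; lra).
      apply Rmult_lt_compat_r; assumption. }
    assert (hw : forall t, itv D t -> phi' t = 0).
    { apply (derivative_vanishes D lambda s theta K (drift m kappa)
               (Derive (drift m kappa)) phi phi' phi''); try assumption; [| lra].
      intros t ht.
      destruct (is_derive_drift m kappa t hm hk (hfin t ht)) as [d [hd hKd]].
      rewrite (is_derive_unique _ _ _ hd); split; assumption. }
    destruct (hphi t0 ht0) as [_ [hd2 he]].
    rewrite (hw t0 ht0), (D_in_zero D phi' phi'' t0 hD ht0 hw hd2) in he.
    assert (lambda * phi t0 = 0) as h0 by lra.
    apply Rmult_integral in h0; tauto.
Qed.

Theorem proposition1p2 (m : nat) (kappa D mu1 : R)
  (hm : (2 <= m)%nat) (hkappa : 0 <= kappa) (hD : 0 < D)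
  (hfin : forall t : R, - (D / 2) <= t <= D / 2 -> drift_finite kappa t)
  (hmu1 : first_nonzero_neumann_eigenvalue m kappa D mu1) :
  Rbar_le
    (Lub_Rbar (fun x : R => exists s : R, 0 < s < 1 /\
       x = 4 * s * (1 - s) * (PI ^ 2 / D ^ 2) + 4 * s * (INR m + 2) * kappa))
    (Finite mu1).
Proof.
  destruct hmu1 as [hev [hne _]].
  apply (proj2 (Lub_Rbar_correct _)).
  intros x [s [hs ->]]; simpl.
  apply nonzero_eigenvalue_lower_bound; try assumption.
  apply Nat.le_trans with 2%nat; [apply Nat.le_succ_diag_r | exact hm].
Qed.
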